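(* Let $n\ge 3$, let $(\mathfrak g,[\cdot,\cdot],\alpha)$ be a multiplicative Hom-Lie algebra over $\mathbb K$, and let $\phi\in\wedge^{n-2}\mathfrak g^*$ satisfy $\phi\wedge\delta\phi_X=0$ for all $X\in\wedge^{n-3}\mathfrak g$ and $\phi\circ(\alpha\otimes\mathrm{Id}\otimes\cdots\otimes\mathrm{Id})=\phi$; let $(\mathfrak g,[\cdot,\dots,\cdot]_\phi,\alpha)$ be the induced $n$-Hom-Lie algebra. Let $k\ge -1$ and let $\theta:\mathfrak g\to\mathfrak g$ be a linear map belonging to the $\alpha^k$-centroid of $(\mathfrak g,[\cdot,\cdot],\alpha)$ such that $$\phi(\theta(x_1),x_2,\dots,x_{n-2})\,[\alpha^k(x),y]=\phi(x_1,x_2,\dots,x_{n-2})\,[\theta(x),y]$$ for all $x_1,\dots,x_{n-2},x,y\in\mathfrak g$. Then $\theta$ belongs to the $\alpha^k$-centroid of $(\mathfrak g,[\cdot,\dots,\cdot]_\phi,\alpha)$.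
   Context: $\mathbb K$ is an algebraically closed field of characteristic zero. A hat denotes omission of an argument. A Hom-Lie algebra is a triple $(\mathfrak g,[\cdot,\cdot],\alpha)$ with $[\cdot,\cdot]:\mathfrak g\times\mathfrak g\to\mathfrak g$ bilinear, $\alpha:\mathfrak g\to\mathfrak g$ linear, such that $[x,y]=-[y,x]$ and $[\alpha(x),[y,z]]+[\alpha(y),[z,x]]+[\alpha(z),[x,y]]=0$. It is multiplicative if $\alpha([x,y])=[\alpha(x),\alpha(y)]$. $\wedge^{n-2}\mathfrak g^*$ is the space of skew-symmetric $(n-2)$-linear forms on $\mathfrak g$. For $X=(x_1,\dots,x_{n-3})$, $\phi_X(z)=\phi(x_1,\dots,x_{n-3},z)$, and for $y_1,\dots,y_n\in\mathfrak g$, $$(\phi\wedge\delta\phi_X)(y_1,\dots,y_n)=\sum_{i<j}(-1)^{i+j}\phi(y_1,\dots,\widehat{y_i},\dots,\widehat{y_j},\dots,y_n)\,\phi_X([y_i,y_j]).$$ The $n$-ary product is $$[x_1,\dots,x_n]_\phi=\sum_{i<j}(-1)^{i+j+1}\phi(x_1,\dots,\widehat{x_i},\dots,\widehat{x_j},\dots,x_n)\,[x_i,x_j].$$ $\alpha^k$ is the $k$-fold composition of $\alpha$, with the conventions $\alpha^0=\mathrm{id}$ and $\alpha^{-1}=0$. For a vector space $\mathcal N$ with an $m$-linear bracket ($m\ge 2$) and a linear map $\alpha$, the $\alpha^k$-centroid is the set of linear maps $\theta:\mathcal N\to\mathcal N$ with $$\theta([x_1,\dots,x_m])=[\theta(x_1),\alpha^k(x_2),\dots,\alpha^k(x_m)]\quad\text{for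 all }x_1,\dots,x_m\in\mathcal N;$$ this is used with $m=2$ for the Hom-Lie bracket and with $m=n$ for $[\cdot,\dots,\cdot]_\phi$. *)

(* Defs.v *)
From HB Require Import structures.
From mathcomp Require Import all_boot all_order all_algebra all_fingroup.
Set Implicit Arguments.
Unset Strict Implicit.
Unset Printing Implicit Defensive.
Import Order.TTheory GRing.Theory Num.Theory.
Local Open Scope ring_scope.

(* An m-tuple (x_1, ..., x_m) of elements of V is a finite function
   x : {ffun 'I_m -> V}; the argument x_i of the mathematical text is x (i - 1). *)

Section Multilinear.
Variables (K : fieldType) (V : lmodType K).

Definition update m (x : {ffun 'I_m -> V}) (i : 'I_m) (v : V)
  : {ffun 'I_m -> V} :=
  [ffun k => if k == i then v else x k].

Definition multilinear_form m (phi : {ffun 'I_m -> V} -> K) : Prop :=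
  forall (x : {ffun 'I_m -> V}) (i : 'I_m) (a : K) (u v : V),
    phi (update x i (a *: u + v))
    = a * phi (update x i u) + phi (update x i v).

Definition skew_symmetric_form m (phi : {ffun 'I_m -> V} -> K) : Prop :=
  forall (s : 'S_m) (x : {ffun 'I_m -> V}),
    phi [ffun k => x (s k)] = (-1) ^+ s * phi x.

Definition exterior_form m (phi : {ffun 'I_m -> V} -> K) : Prop :=
  multilinear_form phi /\ skew_symmetric_form phi.

(* (f x_1, g x_2, ..., g x_m) *)
Definition map_head m (f g : V -> V) (x : {ffun 'I_m -> V})
  : {ffun 'I_m -> V} :=
  [ffun i : 'I_m => if val i == 0%N then f (x i) else g (x i)].

(* (y_1, ..., ^y_i, ..., ^y_j, ..., y_n).  For i != j the list has length
   n - 2, so the default value 0 is never reached. *)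
Definition omit2 n (i j : 'I_n) (y : {ffun 'I_n -> V})
  : {ffun 'I_(n - 2) -> V} :=
  [ffun l : 'I_(n - 2) =>
     nth 0 [seq y k | k <- enum 'I_n & (k != i) && (k != j)] l].

(* phi_X(z) = phi(x_1, ..., x_{n-3}, z); for n >= 3 the list has length
   n - 2, so the default value 0 is never reached. *)
Definition partial_form n (phi : {ffun 'I_(n - 2) -> V} -> K)
    (X : {ffun 'I_(n - 3) -> V}) (z : V) : K :=
  phi [ffun l : 'I_(n - 2) => nth 0 (rcons [seq X k | k <- enum 'I_(n - 3)] z) l].

(* Indices start at 0 here, which shifts i + j by 2 and so does not change
   the signs. *)
Definition wedge_delta (br : V -> V -> V) n
    (phi : {ffun 'I_(n - 2) -> V} -> K) (psi : V -> K)
    (y : {ffun 'I_n -> V}) : K :=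
  \sum_(i < n) \sum_(j < n | (i < j)%N)
    (-1) ^+ (i + j)%N * phi (omit2 i j y) * psi (br (y i) (y j)).

Definition nbracket (br : V -> V -> V) n
    (phi : {ffun 'I_(n - 2) -> V} -> K) (x : {ffun 'I_n -> V}) : V :=
  \sum_(i < n) \sum_(j < n | (i < j)%N)
    ((-1) ^+ (i + j).+1 * phi (omit2 i j x)) *: br (x i) (x j).

End Multilinear.

Section HomLie.
Variables (K : fieldType) (g : lmodType K).

Record hom_Lie (br : {bilinear g -> g -> g}) (alpha : {linear g -> g})
    : Prop := HomLie {
  hom_Lie_skew : forall x y : g, br x y = - br y x;
  hom_Lie_jacobi : forall x y z : g,
    br (alpha x) (br y z) + br (alpha y) (br z x) + br (alpha z) (br x y) = 0
}.

Definition multiplicative_hom_Lie (br : {bilinear g -> g -> g})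
    (alpha : {linear g -> g}) : Prop :=
  hom_Lie br alpha /\ forall x y : g, alpha (br x y) = br (alpha x) (alpha y).

(* alpha^k, with alpha^{-1} = 0; the value for k < -1 is irrelevant. *)
Definition iter_twist (alpha : g -> g) (k : int) : g -> g :=
  match k with
  | Posz m => iter m alpha
  | Negz _ => fun=> 0
  end.

Definition in_centroid m (br : {ffun 'I_m -> g} -> g) (alpha : g -> g)
    (k : int) (theta : {linear g -> g}) : Prop :=
  forall x : {ffun 'I_m -> g},
    theta (br x) = br (map_head theta (iter_twist alpha k) x).

Definition bracket2 (br : g -> g -> g) (x : {ffun 'I_2 -> g}) : g :=
  br (x ord0) (x ord_max).

End HomLie.

(* Main.v *)
(** Since [phi] is skew-symmetric, its invariance under [alpha] in the first
    argument spreads to every argument.  For [k >= 0] the proposition then holds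
    term by term: if [x_1] lies in the bracket of a term of [[x_1, ..., x_n]_phi],
    this is the centroid condition alone, and if [x_1] is an argument of [phi],
    the hypothesis relating [phi] and [theta] moves [theta] from [phi] to the
    bracket.  For [k = -1] both sides vanish term by term. *)
Require Import Defs.
From HB Require Import structures.
From mathcomp Require Import all_boot all_order all_algebra all_fingroup.
Set Implicit Arguments.
Unset Strict Implicit.
Unset Printing Implicit Defensive.
Import Order.TTheory GRing.Theory Num.Theory.
Local Open Scope ring_scope.

Section Invariance.
Variables (K : fieldType) (V : lmodType K) (m : nat).
Variable phi : {ffun 'I_m -> V} -> K.

(** Conjugating by the transposition of the head and [i] carries slot [i] to the head and back; its
    sign occurs twice and cancels. *)
Lemma skew_symmetric_update (f : V -> V) :
    skew_symmetric_form phi -> (forall x, phi (map_head f id x) = phi x) ->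
  forall x i, phi (update x i (f (x i))) = phi x.
Proof.
move=> phi_skew phi_f x i.
have m_gt0 : (0 < m)%N by apply: leq_ltn_trans (ltn_ord i).
pose t := tperm (Ordinal m_gt0) i; pose y : {ffun 'I_m -> V} := [ffun l => x (t l)].
have -> : update x i (f (x i)) = [ffun l => map_head f id y (t l)].
  apply/ffunP=> l; rewrite !ffunE tpermK.
  have -> : (val (t l) == 0%N) = (l == i).
    by rewrite -(can_eq (tpermK (Ordinal m_gt0) i) l i) tpermR.
  by case: eqP => [->|].
rewrite phi_skew phi_f -phi_skew; congr phi.
by apply/ffunP=> l; rewrite !ffunE tpermK.
Qed.

Lemma invariant_update_iter (f : V -> V) :
    (forall x i, phi (update x i (f (x i))) = phi x) ->
  forall k x i, phi (update x i (iter k f (x i))) = phi x.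
Proof.
move=> phi_f; elim=> [|k IHk] x i.
  by congr phi; apply/ffunP=> l; rewrite ffunE; case: eqP => [->|].
rewrite -(IHk x i) -(phi_f (update x i (iter k f (x i))) i); congr phi.
by apply/ffunP=> l; rewrite !ffunE eqxx; case: eqP.
Qed.

Lemma invariant_map_on (f : V -> V) :
    (forall x i, phi (update x i (f (x i))) = phi x) ->
  forall (P : pred 'I_m) (x : {ffun 'I_m -> V}),
  phi [ffun l => if P l then f (x l) else x l] = phi x.
Proof.
move=> phi_f P x.
(* The slots are treated one at a time; [uniq s] ensures that [f] hits none of them twice. *)
have phi_seq (s : seq 'I_m) : uniq s ->
    phi [ffun l => if l \in s then f (x l) else x l] = phi x.
  elim: s => [|i s IHs] /=; first by move=> _; congr phi; apply/ffunP=> l; rewrite ffunE.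
  case/andP=> i_s /IHs <-; rewrite -[RHS](phi_f _ i); congr phi.
  apply/ffunP=> l; rewrite !ffunE inE; case: eqP => [->|] //=.
  by rewrite (negPf i_s).
rewrite -(phi_seq _ (enum_uniq P)); congr phi.
by apply/ffunP=> l; rewrite !ffunE mem_enum.
Qed.

End Invariance.

Section Omit.
Variables (K : fieldType) (V : lmodType K) (n : nat).
Implicit Types (x : {ffun 'I_n -> V}) (f h : V -> V).

Lemma size_omit2 (i j : 'I_n) : i != j ->
  size [seq k <- enum 'I_n | (k != i) && (k != j)] = (n - 2)%N.
Proof.
move=> neq_ij; rewrite -[n in RHS]card_ord -(cardC (pred2 i j)) card2 neq_ij addKn.
rewrite cardE enumT [in RHS]/enum_mem; congr size.
by apply: eq_filter => k; rewrite !inE negb_or.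
Qed.

(** Passing from entries to their indices lets [map_head] be decided by comparing an index with 0.
    As [l] is below the list size, any default [i0] will do. *)
Lemma omit2E (i j i0 : 'I_n) x l : i != j ->
  omit2 i j x l = x (nth i0 [seq k <- enum 'I_n | (k != i) && (k != j)] l).
Proof. by move=> neq_ij; rewrite ffunE (nth_map i0) // size_omit2. Qed.

Lemma omit2_map_head_omitted f h x (i j : 'I_n) : (i < j)%N -> val i = 0%N ->
  omit2 i j (map_head f h x) = [ffun l => h (omit2 i j x l)].
Proof.
move=> lt_ij i0; have neq_ij : i != j by rewrite -val_eqE ltn_eqF.
apply/ffunP=> l; rewrite [RHS]ffunE !(omit2E i) // ffunE.
have: nth i [seq k <- enum 'I_n | (k != i) && (k != j)] l \in
      [seq k <- enum 'I_n | (k != i) && (k != j)].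
  by rewrite mem_nth // size_omit2.
by rewrite mem_filter -!val_eqE /= i0 => /andP[/andP[/negPf-> _] _].
Qed.

Lemma omit2_map_head_kept f h x (i j : 'I_n) : (0 < i < j)%N ->
  omit2 i j (map_head f h x) = map_head f h (omit2 i j x).
Proof.
case/andP=> i_gt0 lt_ij; have neq_ij : i != j by rewrite -val_eqE ltn_eqF.
have n_gt0 : (0 < n)%N by apply: leq_ltn_trans (ltn_ord i).
pose i0 := Ordinal n_gt0.
set s := [seq k <- enum 'I_n | (k != i) && (k != j)].
have s0 : nth i0 s 0 = i0.
  (* Once [n] is a successor, the enumeration starts with index 0, which survives the filter because
     [i] and [j] are positive. *)
  rewrite /s /i0; move: (n_gt0) (i) (j) i_gt0 lt_ij {neq_ij i0 s}.
  case: (n) => // p ? i' j' i'_gt0 lt_ij'.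
  rewrite enum_ordSl /= -!val_eqE /= ltn_eqF // ltn_eqF //=.
    exact: val_inj.
  exact: leq_ltn_trans lt_ij'.
apply/ffunP=> l; rewrite [RHS]ffunE !(omit2E i0) // ffunE -/s.
suff -> : (val (nth i0 s l) == 0%N) = (val l == 0%N) by [].
have sz_s : size s = (n - 2)%N by apply: size_omit2.
(* The kept indices are distinct, so index 0 sits in slot 0 only; the existence of [l] shows that
   slot 0 is in range. *)
rewrite -[X in _ == X]/(val i0) val_eqE -[X in _ == X]s0 nth_uniq ?sz_s //.
  exact: leq_ltn_trans (ltn_ord l).
by rewrite filter_uniq // enum_uniq.
Qed.

End Omit.

Theorem proposition2p8 (K : closedFieldType) (charK : [pchar K] =i pred0)
  (n : nat) (n_ge3 : (3 <= n)%N)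
  (g : lmodType K) (br : {bilinear g -> g -> g}) (alpha : {linear g -> g})
  (g_homLie : multiplicative_hom_Lie br alpha)
  (phi : {ffun 'I_(n - 2) -> g} -> K) (phi_ext : exterior_form phi)
  (phi_wedge : forall (X : {ffun 'I_(n - 3) -> g}) (y : {ffun 'I_n -> g}),
     wedge_delta br phi (partial_form phi X) y = 0)
  (phi_alpha : forall x : {ffun 'I_(n - 2) -> g},
     phi (map_head alpha id x) = phi x)
  (k : int) (k_geN1 : -1 <= k)
  (theta : {linear g -> g})
  (theta_centroid : in_centroid (bracket2 br) alpha k theta)
  (theta_phi : forall (xs : {ffun 'I_(n - 2) -> g}) (x y : g),
     phi (map_head theta id xs) *: br (iter_twist alpha k x) y
     = phi xs *: br (theta x) y) :
  in_centroid (nbracket br phi) alpha k theta.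
Proof.
have theta_br u v : theta (br u v) = br (theta u) (iter_twist alpha k v).
  pose x : {ffun 'I_2 -> g} := [ffun l => if l == ord0 then u else v].
  by have := theta_centroid x; rewrite /bracket2 !ffunE.
move=> x; rewrite /nbracket raddf_sum; apply: eq_bigr => i _.
rewrite raddf_sum; apply: eq_bigr => j lt_ij.
rewrite /= linearZ /= -!scalerA theta_br; congr (_ *: _).
(* Only [i] can be the head, so the second bracket argument always carries [alpha^k]. *)
have j_gt0 : (0 < j)%N by apply: leq_ltn_trans lt_ij.
have -> : map_head theta (iter_twist alpha k) x j = iter_twist alpha k (x j).
  by rewrite ffunE /= gtn_eqF.
case: k theta_br {k_geN1 theta_centroid} theta_phi => [k|k] _ theta_phi; last first.
  by rewrite /= !linear0r !scaler0.
have phi_iter := invariant_map_on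
  (invariant_update_iter (skew_symmetric_update phi_ext.2 phi_alpha) k).
have [i0|i_neq0] := eqVneq (val i) 0%N.
  rewrite omit2_map_head_omitted // [map_head _ _ x i]ffunE i0 /=.
  (* The brackets agree already; [alpha^k] is inserted in all arguments of [phi]. *)
  by congr (_ *: _); rewrite -(phi_iter predT).
have i_gt0 : (0 < i)%N by rewrite lt0n.
rewrite omit2_map_head_kept ?i_gt0 // [map_head _ _ x i]ffunE (negPf i_neq0).
(* With [theta] moved to the head of [phi], invariance supplies [alpha^k] in the remaining slots. *)
rewrite -theta_phi -(phi_iter (fun l => val l != 0%N)); congr (phi _ *: _).
by apply/ffunP=> l; rewrite !ffunE; case: eqP.
Qed.
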